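(* Let $(H,\|\cdot\|_H)$ be a Banach space and let $\{X_t(x):\ x\in[0,1]^d,\ t\in[0,1]\}$ be an $H$-valued stochastic field on a probability space $(\Omega,\mathcal F,\mathbb P)$. Let $\varphi$ be a nonnegative, nondecreasing, continuous function on $(0,+\infty)$ with $\lim_{r\to0+}\varphi(r)=0$. Suppose there exist constants $\gamma>0$ and $C>0$ such that $$\mathbb E\Big[\sup_{0\le t\le 1}\|X_t(x)-X_t(y)\|_H^\gamma\Big]\le C|x-y|^d\varphi(|x-y|),\qquad x,y\in[0,1]^d,$$ and there exists another constant $0<\vartheta<1/\gamma$ such that $$\sum_{i=0}^\infty \varphi(2^{-i})^{\vartheta}<+\infty \ \text{ when } \gamma\ge1,\qquad\text{and}\qquad \sum_{i=0}^\infty\varphi(2^{-i})^{\gamma\vartheta}<+\infty\ \text{ when }\gamma<1.$$ Further assume that there is a constant $\lambda\ge1$ such that for all sufficiently large natural numbers $n$, $$\lambda^{-1}\le\frac{\varphi(2^{-n})}{\varphi(2^{-n-1})}\le\lambda .$$ Then there is a realization $\tilde X$ of $X$ such that $\tilde X$ is continuous in $x$ and, for every $\alpha\in(0,1/\gamma-\vartheta]$, $$\mathbb E\Big[\sup_{0\le t\le1}[\tilde X_t(\cdot)]_{\alpha,\varphi}^\gamma\Big]<+\infty,$$ where $$[\tilde X_t(\cdot)]_{\alpha,\varphi}:=\sup\Big\{\frac{\|\tilde X_t(x)-\tilde X_t(y)\|_H}{\varphi(|x-y|)^\alpha}:\ x,y\in[0,1]^d,\ x\ne y\Big\}.$$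
   Context: Here $d\ge1$ is an integer and $|\cdot|$ is the Euclidean norm on $\mathbb R^d$; $\varphi(0)$ is read as $0$. A realization $\tilde X$ of $X$ is an $H$-valued stochastic field on the same probability space and with the same index set such that, for each $x\in[0,1]^d$, $\mathbb P\{\tilde X_t(x)=X_t(x)\text{ for all }t\in[0,1]\}=1$. ''Continuous in $x$'' means that for almost every $\omega$, for every $t\in[0,1]$, the map $x\mapsto\tilde X_t(x,\omega)$ is continuous on $[0,1]^d$. Writing the expectation of a supremum over $t$ presupposes that this supremum is a random variable. *)

(* Defs.v *)
From HB Require Import structures.
From mathcomp Require Import all_boot all_order all_algebra.
From mathcomp Require Import all_classical all_reals all_analysis.
From mathcomp Require Import measurable_realfun.
Import Order.TTheory GRing.Theory Num.Theory.
Import numFieldNormedType.Exports.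

Set Implicit Arguments.
Unset Strict Implicit.
Unset Printing Implicit Defensive.

Local Open Scope classical_set_scope.
Local Open Scope ring_scope.

(* The library norm on ['rV[R]_d] is the sup norm, hence this definition; both
   norms induce the topology carried by ['rV[R]_d]. *)
Definition enorm (R : realType) (d : nat) (x : 'rV[R]_d) : R :=
  Num.sqrt (\sum_(i < d) x ord0 i ^+ 2).

Definition unit_cube (R : realType) (d : nat) : set 'rV[R]_d :=
  [set x | forall i, x ord0 i \in `[0, 1]].

(* The supremum over 0 <= t <= 1, in the extended reals. *)
Definition sup01 (R : realType) (f : R -> \bar R) : \bar R :=
  ereal_sup [set f t | t in `[0, 1]%classic].

(* A field [X t x w] is a total function of [t] and [x]; only the indices [t] in
   [0, 1] and [x] in the unit cube are meaningful.  [H] carries its Borel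
   sigma-algebra. *)
Definition stochastic_field (R : realType) (H : completeNormedModType R)
    (d : nat) (disp : measure_display) (T : measurableType disp)
    (X : R -> 'rV[R]_d -> T -> H) : Prop :=
  forall (t : R) (x : 'rV[R]_d), t \in `[0, 1] -> unit_cube x ->
    measurable_fun [set: T] (X t x : T -> g_sigma_algebraType (@open H)).

(* [P] is only meaningful on measurable sets, so that an event of probability
   one is required to be measurable. *)
Definition realization (R : realType) (H : completeNormedModType R)
    (d : nat) (disp : measure_display) (T : measurableType disp)
    (P : probability T R) (X Y : R -> 'rV[R]_d -> T -> H) : Prop :=
  stochastic_field Y /\
  forall x, unit_cube x ->
    let E := [set w | forall t : R, t \in `[0, 1] -> Y t x w = X t x w] in
    measurable E /\ P E = 1%E.

Definition continuous_in_space (R : realType) (H : completeNormedModType R)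
    (d : nat) (disp : measure_display) (T : measurableType disp)
    (P : probability T R) (X : R -> 'rV[R]_d -> T -> H) : Prop :=
  {ae P, forall w, forall t : R, t \in `[0, 1] ->
    {within @unit_cube R d, continuous (fun x => X t x w)}}.

Definition phi_seminorm (R : realType) (H : completeNormedModType R) (d : nat)
    (phi : R -> R) (alpha : R) (f : 'rV[R]_d -> H) : \bar R :=
  ereal_sup [set (`|f p.1 - f p.2| / phi (enorm (p.1 - p.2)) `^ alpha)%:E |
    p in [set p : 'rV[R]_d * 'rV[R]_d |
            [/\ unit_cube p.1, unit_cube p.2 & p.1 != p.2]]].

(* Finiteness of the expectation of a nonnegative extended-real function; the
   library integral is total, so the measurability of [Z] is required. *)
Definition finite_expectation (R : realType) (disp : measure_display)
    (T : measurableType disp) (P : probability T R) (Z : T -> \bar R) : Prop :=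
  measurable_fun [set: T] Z /\ (\int[P]_w Z w < +oo)%E.

(* Main.v *)
(* Let Xi_m be the sum of sup_t |X_t(x) - X_t(y)|^gamma over the pairs of
   neighbouring dyadic points of level m.  There are about 2^(md) such pairs, so the
   moment bound gives E Xi_m <= const * phi(2^-m).  With
   q = theta * min(gamma, 1), the random variable
   U = sum_m phi(2^-m)^(q - 1) Xi_m has E U <= const * sum_m phi(2^-m)^q < oo,
   and wherever U is finite, chaining along dyadic projections yields
     |X_t(x) - X_t(y)| <= const * (U + 1)^(1/gamma) * phi(|x - y|)^(1/gamma - theta)
   for dyadic x, y, uniformly in t.  Extending by uniform continuity gives a
   version obeying this bound everywhere, so the gamma-th power of its seminorm is
   at most const * (U + 1).  All suprema over space reduce to dyadic points, where
   the version agrees with X; this is what makes them measurable. *)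
Require Import Defs.
From HB Require Import structures.
From mathcomp Require Import all_boot all_order all_algebra.
From mathcomp Require Import all_classical all_reals all_analysis.
From mathcomp Require Import measurable_realfun.
From mathcomp Require Import ring lra zify.
Import Order.TTheory GRing.Theory Num.Theory.
Import numFieldNormedType.Exports.

Set Implicit Arguments.
Unset Strict Implicit.
Unset Printing Implicit Defensive.

Local Open Scope classical_set_scope.
Local Open Scope ring_scope.

(** * Euclidean norm and coordinates *)

Section euclidean_norm.
Variables (R : realType) (d : nat).
Implicit Types x y : 'rV[R]_d.

Lemma enorm_ge0 x : 0 <= enorm x.
Proof. exact: sqrtr_ge0. Qed.

Lemma enorm0 : enorm (0 : 'rV[R]_d) = 0.
Proof. by rewrite /enorm big1 ?sqrtr0// => i _; rewrite mxE expr0n. Qed.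

Lemma coordB x y i : (x - y) ord0 i = x ord0 i - y ord0 i.
Proof. by rewrite !mxE. Qed.

Lemma coord_le_enorm x i : `|x ord0 i| <= enorm x.
Proof.
rewrite -sqrtr_sqr ler_wsqrtr// (bigD1 i)//= lerDl.
by apply: sumr_ge0 => j _; exact: sqr_ge0.
Qed.

Lemma enorm_gt0 x : x != 0 -> 0 < enorm x.
Proof.
apply: contraNT; rewrite -leNgt => x0; apply/eqP/rowP => i; rewrite mxE.
by apply/eqP; rewrite -normr_le0 (le_trans (coord_le_enorm x i)).
Qed.

Lemma enorm_le x (M : R) : (1 <= d)%N -> 0 <= M ->
  (forall i, `|x ord0 i| <= M) -> enorm x <= d%:R * M.
Proof.
move=> d1 M0 xM; rewrite -(ger0_norm (mulr_ge0 (ler0n R d) M0)) -sqrtr_sqr.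
apply: ler_wsqrtr; rewrite exprMn.
apply: (@le_trans _ _ (\sum_(i < d) M ^+ 2)).
  by apply: ler_sum => i _; rewrite -real_normK ?num_real// lerXn2r ?nnegrE.
rewrite sumr_const card_ord -[leLHS]mulr_natl ler_wpM2r ?sqr_ge0//.
by rewrite expr2 ler_peMl// ler1n.
Qed.

Lemma cvg_enorm (u : nat -> 'rV[R]_d) x :
  (forall i, u n ord0 i @[n --> \oo] --> x ord0 i) ->
  enorm (u n) @[n --> \oo] --> enorm x.
Proof.
move=> ux; apply: (continuous_cvg _ (@sqrt_continuous R _)).
elim: (index_enum _) => [|i s IHs].
  by rewrite big_nil; under eq_fun do rewrite big_nil; exact: cvg_cst.
rewrite big_cons; under eq_fun do rewrite big_cons.
by apply: cvgD => //; rewrite expr2; under eq_fun do rewrite expr2; exact: cvgM.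
Qed.

End euclidean_norm.

(** * Dyadic grids in the unit cube *)

Section dyadic_points.
Variables (R : realType) (d : nat).
Implicit Types (x y : 'rV[R]_d) (m n k : nat) (a : 'I_d -> nat).

(** Clipping the indices at [2 ^ m] sends every index function into the cube, with no side condition
    to carry. *)
Definition dyadic_pt m a : 'rV[R]_d :=
  \row_i ((minn (a i) (2 ^ m))%:R / 2 ^+ m).

Definition dyadic_floor m x : 'rV[R]_d :=
  dyadic_pt m (fun i => Num.truncn (2 ^+ m * x ord0 i)).

Lemma dyadic_pt_cube m a : unit_cube (dyadic_pt m a).
Proof.
move=> i; rewrite mxE in_itv/= divr_ge0// ler_pdivrMr ?exprn_gt0// mul1r.
by rewrite -natrX ler_nat geq_minr.
Qed.

Lemma dyadic_floor_bounds m x i : unit_cube x ->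
  0 <= x ord0 i - dyadic_floor m x ord0 i < 2 ^- m.
Proof.
move=> /(_ i); rewrite in_itv/= => /andP[x0 x1]; rewrite !mxE.
have p0 : (0 : R) < 2 ^+ m by rewrite exprn_gt0.
have /truncn_itv/andP[t0 t1] : 0 <= 2 ^+ m * x ord0 i by rewrite mulr_ge0// ltW.
rewrite (minn_idPl _); last first.
  rewrite -(ler_nat R) (le_trans t0)// natrX ler_piMr// ltW//.
rewrite subr_ge0 ler_pdivrMr// [x ord0 i * _]mulrC t0/= ltrBlDl.
by rewrite -[X in _ + X]mul1r -mulrDl ltr_pdivlMr// natr1 mulrC.
Qed.

(** The grids are nested, so the projections of a dyadic point are eventually the point itself and
    chains ending at it are finite. *)
Lemma dyadic_floorK m k a : (m <= k)%N ->
  dyadic_floor k (dyadic_pt m a) = dyadic_pt m a.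
Proof.
move=> mk; apply/rowP => i; rewrite !mxE.
set j := minn (a i) _; have jm : (j <= 2 ^ m)%N by exact: geq_minr.
have e2 : (2 : R) ^+ k = 2 ^+ (k - m) * 2 ^+ m by rewrite -exprD subnK.
have -> : 2 ^+ k * (j%:R / 2 ^+ m) = (2 ^ (k - m) * j)%:R :> R.
  by rewrite natrM natrX e2; field; rewrite expf_neq0.
rewrite natrK (minn_idPl _); last first.
  by rewrite -(subnK mk) expnD addnK leq_mul2l jm orbT.
by rewrite natrM natrX e2; field; rewrite ?expf_neq0.
Qed.

Lemma dyadic_pt_lift m k a : (m <= k)%N ->
  exists a', dyadic_pt m a = dyadic_pt k a'.
Proof. by move=> mk; rewrite -(dyadic_floorK a mk); eexists. Qed.

Lemma cvg_half_pow : (2 ^- n : R) @[n --> \oo] --> 0.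
Proof.
have := @cvg_geometric R 1 2^-1; rewrite ger0_norm// invf_lt1// ltr1n.
move=> /(_ isT); apply: cvg_trans; apply: near_eq_cvg; near=> n.
by rewrite /geometric/= mul1r exprVn.
Unshelve. all: by end_near. Qed.

Lemma cvg_dyadic_floor x i : unit_cube x ->
  dyadic_floor n x ord0 i @[n --> \oo] --> x ord0 i.
Proof.
move=> xc; apply/cvgrPdist_le => e e0.
have /cvgrPdist_le/(_ e e0) := cvg_half_pow; apply: filterS => n /=.
rewrite sub0r normrN ger0_norm ?invr_ge0 ?exprn_ge0//; apply: le_trans.
by have /andP[? ?] := dyadic_floor_bounds n i xc; rewrite ger0_norm// ltW.
Qed.

Lemma enorm_floor_le n x : (1 <= d)%N -> unit_cube x ->
  enorm (dyadic_floor n x - x) <= d%:R * 2 ^- n.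
Proof.
move=> d1 xc; apply: enorm_le => // i.
rewrite coordB distrC.
by have /andP[? ?] := dyadic_floor_bounds n i xc; rewrite ger0_norm// ltW.
Qed.

Lemma cvg_enorm_floor x y : unit_cube x -> unit_cube y ->
  enorm (dyadic_floor n x - dyadic_floor n y) @[n --> \oo] --> enorm (x - y).
Proof.
move=> xc yc; apply: cvg_enorm => i.
under eq_fun do rewrite coordB.
by rewrite coordB; apply: cvgB; exact: cvg_dyadic_floor.
Qed.

(** Take the least [n] with [2 ^- n] at most the distance; minimality bounds the distance by twice
    that. The first bound feeds the monotonicity of the modulus, the second makes the level [n]
    projections neighbours. *)
Lemma dyadic_scale x y : unit_cube x -> unit_cube y -> x != y ->
  exists n, 2 ^- n <= enorm (x - y) /\
    forall i, `|x ord0 i - y ord0 i| <= 2 * 2 ^- n.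
Proof.
move=> xc yc xy; have r0 : 0 < enorm (x - y) by rewrite enorm_gt0// subr_eq0.
have ex : exists n, 2 ^- n <= enorm (x - y).
  have /cvgrPdist_lt/(_ _ r0) := cvg_half_pow => -[n _ /(_ n (leqnn n))].
  by rewrite sub0r normrN ger0_norm ?invr_ge0 ?exprn_ge0// => /ltW; exists n.
case: (ex_minnP ex) => n nr nmin; exists n; split => // i.
(* Level 0 has no predecessor to contradict minimality; there the width 1 of the cube suffices. *)
case: n nr nmin => [|n] nr nmin.
  rewrite expr0 invr1 mulr1.
  have := xc i; have := yc i; rewrite !in_itv/= => /andP[? ?] /andP[? ?].
  by rewrite ler_norml; lra.
rewrite exprS invfM mulrA divff// mul1r.
have /ltW : enorm (x - y) < 2 ^- n.
  by rewrite ltNge; apply/negP => /nmin; rewrite ltnn.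
by apply: le_trans; have := coord_le_enorm (x - y) i; rewrite !mxE.
Qed.

End dyadic_points.

(** * Chaining on dyadic points *)

Section chaining.
Variables (R : realType) (d : nat) (H : completeNormedModType R).
Hypothesis d_gt0 : (1 <= d)%N.
Implicit Types (psi : R -> R) (f : 'rV[R]_d -> H) (x y : 'rV[R]_d).

Definition dyadic x := exists m a, x = dyadic_pt R m a.

Lemma dyadic_cube x : dyadic x -> unit_cube x.
Proof. by move=> [m [a ->]]; exact: dyadic_pt_cube. Qed.

Lemma dyadic_dyadic_floor n x : dyadic (dyadic_floor n x).
Proof. by eexists; eexists. Qed.

Lemma dyadic_floor_id x : dyadic x ->
  \forall n \near \oo, dyadic_floor n x = x.
Proof. by move=> [m [a ->]]; exists m => // n /= mn; rewrite dyadic_floorK. Qed.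

Section increments.
Variables (psi : R -> R) (f : 'rV[R]_d -> H) (b : nat -> R).
Hypothesis psi_ge0 : forall r : R, 0 <= r -> 0 <= psi r.
Hypothesis psi_nd : forall r s : R, 0 < r -> r <= s -> psi r <= psi s.
Hypothesis b_ge0 : forall n, 0 <= b n.
Hypothesis f_incr : forall m a a',
  (forall i, `|dyadic_pt R m a ord0 i - dyadic_pt R m a' ord0 i| <=
    4 * 2 ^- m) ->
  `|f (dyadic_pt R m a) - f (dyadic_pt R m a')| <= psi (2 ^- m) * b m.

(** Successive projections are neighbours at the finer level, and [psi (2 ^- n)] majorises all finer
    values of [psi], so that only [b] is summed. *)
Lemma chaining_floor n l x : unit_cube x ->
  `|f (dyadic_floor (n + l) x) - f (dyadic_floor n x)| <=
  psi (2 ^- n) * \sum_(n.+1 <= j < (n + l).+1) b j.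
Proof.
move=> xc; elim: l => [|l IHl].
  by rewrite addn0 subrr normr0 big_geq// mulr0.
rewrite addnS big_nat_recr/=; last by rewrite ltnS leq_addr.
rewrite mulrDr [leRHS]addrC.
apply: (le_trans (ler_distD (f (dyadic_floor (n + l) x)) _ _)); apply: lerD => //.
apply: (@le_trans _ _ (psi (2 ^- (n + l).+1) * b (n + l).+1)); last first.
  apply: ler_wpM2r => //; apply: psi_nd; first by rewrite invr_gt0 exprn_gt0.
  rewrite lef_pV2 ?posrE ?exprn_gt0// ler_weXn2l ?ler1n//.
  by rewrite ltnW// ltnS leq_addr.
(* The coarser projection is read as a point of the finer grid, since [f_incr] compares points of
   one level. *)
have [a' e] := @dyadic_pt_lift R d (n + l) (n + l).+1
  (fun i => Num.truncn (2 ^+ (n + l) * x ord0 i)) (leqnSn _).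
rewrite {2}/dyadic_floor e; apply: f_incr => i; rewrite -e.
have /andP[] := dyadic_floor_bounds (n + l) i xc.
have /andP[] := dyadic_floor_bounds (n + l).+1 i xc.
rewrite -!/(dyadic_floor _ _) => ? ? ?.
have -> : (2 : R) ^- (n + l) = 2 * 2 ^- (n + l).+1.
  by rewrite exprS; field; rewrite expf_neq0.
move=> ?; rewrite ler_norml; lra.
Qed.

(** Go from [x] to its projection at the scale of the distance, across to that of [y], then on to
    [y]. Both chains obey the same bound [S], and [b n + 2 * S <= 2 * (b n + S) <= 2 * B]. *)
Lemma dyadic_chaining (B : R) x y : (forall n, \sum_(0 <= m < n) b m <= B) ->
  dyadic x -> dyadic y -> x != y ->
  `|f x - f y| <= 2 * B * psi (enorm (x - y)).
Proof.
move=> bB xd yd xy; have xc := dyadic_cube xd; have yc := dyadic_cube yd.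
have [n [nxy xyn]] := dyadic_scale xc yc xy.
have [l [xl yl]] : exists l,
    dyadic_floor (n + l) x = x /\ dyadic_floor (n + l) y = y.
  have [m [a xe]] := xd; have [m' [a' ye]] := yd; exists (m + m')%N.
  split; first by rewrite xe dyadic_floorK// addnCA leq_addr.
  by rewrite ye dyadic_floorK// addnA leq_addl.
have b0 : 0 <= psi (2 ^- n) by apply: psi_ge0; rewrite invr_ge0 exprn_ge0.
have fxy : `|f (dyadic_floor n x) - f (dyadic_floor n y)| <= psi (2 ^- n) * b n.
  (* The coordinates of [x] and [y] differ by at most [2 * 2 ^- n] and rounding adds less than
     [2 ^- n], which stays within [4 * 2 ^- n]. *)
  apply: f_incr => i; have := xyn i.
  have /andP[] := dyadic_floor_bounds n i xc.
  have /andP[] := dyadic_floor_bounds n i yc.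
  rewrite -!/(dyadic_floor _ _) => ? ? ? ?.
  by rewrite !ler_norml => /andP[? ?]; lra.
have := chaining_floor n l xc; have := chaining_floor n l yc.
rewrite xl yl; set S := \sum_(_ <= _ < _) _ => hy hx.
have S0 : 0 <= S by rewrite sumr_ge0.
have bS : b n + S <= B.
  apply: le_trans (bB (n + l).+1).
  rewrite (big_cat_nat (n := n)) //=; last by rewrite ltnW// ltnS leq_addr.
  by rewrite [X in _ <= _ + X]big_ltn ?ltnS ?leq_addr// lerDr sumr_ge0.
apply: (@le_trans _ _ (2 * B * psi (2 ^- n))); last first.
  apply: ler_wpM2l; last by apply: psi_nd => //; rewrite invr_gt0 exprn_gt0.
  by rewrite mulr_ge0// (le_trans _ bS)// addr_ge0.
have -> : f x - f y = (f x - f (dyadic_floor n x)) +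
    (f (dyadic_floor n x) - f (dyadic_floor n y)) -
    (f y - f (dyadic_floor n y)).
  by rewrite addrA subrK opprB addrA subrK.
apply: (le_trans (ler_normB _ _)).
apply: (le_trans (lerD (ler_normD _ _) (lexx _))).
apply: (le_trans (lerD (lerD hx fxy) hy)).
rewrite -!mulrDr mulrC ler_wpM2r//.
by have := b_ge0 n; lra.
Qed.

End increments.

(** * Extension to the cube by uniform continuity *)

Section extension.
Variables (psi : R -> R) (f : 'rV[R]_d -> H) (K : R).
Hypothesis K_ge0 : 0 <= K.
Hypothesis psi_small : forall e : R, 0 < e ->
  exists2 r0 : R, 0 < r0 & forall r : R, 0 <= r -> r <= r0 -> psi r <= e.
Hypothesis psi_cont : forall r : R, 0 < r -> {for r, continuous psi}.

Lemma modulus_small (e : R) : 0 < e ->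
  exists2 r0 : R, 0 < r0 & forall r : R, 0 <= r -> r <= r0 -> K * psi r < e.
Proof.
(* [K + 1] avoids dividing by a possibly zero [K]. *)
move=> e0; have [//|r0 r00 hr0] := psi_small (e := e / (K + 1)).
  by rewrite divr_gt0// ltr_wpDl.
exists r0 => // r rge0 rr0; apply: (@le_lt_trans _ _ (K * (e / (K + 1)))).
  by rewrite ler_wpM2l// hr0.
have K1 : 0 < K + 1 by rewrite ltr_wpDl.
by rewrite mulrCA gtr_pMr// ltr_pdivrMr// mul1r ltrDl.
Qed.

(** The rank [N] is uniform over the cube, and closeness is coordinatewise because that is what
    dyadic rounding supplies. *)
Lemma modulus_floor_small (e : R) : 0 < e ->
  exists N, forall n x y, unit_cube x -> unit_cube y ->
    (forall i, `|x ord0 i - y ord0 i| <= 2 ^- n) -> (N <= n)%N ->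
    K * psi (enorm (x - y)) < e.
Proof.
move=> e0; have [r0 r00 hr0] := modulus_small e0.
have /cvgrPdist_lt/(_ (r0 / d%:R)) := @cvg_half_pow R.
rewrite divr_gt0 ?ltr0n// => /(_ isT)[N _ hN].
exists N => n x y xc yc xy Nn; apply: hr0; first exact: enorm_ge0.
apply: (@le_trans _ _ (d%:R * 2 ^- n)).
  by apply: enorm_le => // i; rewrite coordB xy.
have := hN n Nn; rewrite /= sub0r normrN ger0_norm ?invr_ge0 ?exprn_ge0//.
by rewrite ltr_pdivlMr ?ltr0n// mulrC => /ltW.
Qed.

Definition dyadic_extension x : H := lim (f (dyadic_floor n x) @[n --> \oo]).

Hypothesis f_mod : forall x y, dyadic x -> dyadic y ->
  `|f x - f y| <= K * psi (enorm (x - y)).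

Lemma cvg_dyadic_extension x : unit_cube x ->
  f (dyadic_floor n x) @[n --> \oo] --> dyadic_extension x.
Proof.
move=> xc; apply/cauchy_cvgP; apply: cauchy_exP => e e0.
have [N hN] := modulus_floor_small e0.
exists (f (dyadic_floor N x)), N => // n /= Nn; rewrite -ball_normE/=.
apply: (le_lt_trans (f_mod (dyadic_dyadic_floor _ _) (dyadic_dyadic_floor _ _))).
apply: (hN N) => // [||i]; try exact: dyadic_pt_cube.
have /andP[] := dyadic_floor_bounds n i xc.
have /andP[] := dyadic_floor_bounds N i xc.
have : (2 : R) ^- n <= 2 ^- N.
  by rewrite lef_pV2 ?posrE ?exprn_gt0// ler_weXn2l ?ler1n.
by move=> ? ? ? ? ?; rewrite ler_norml; lra.
Qed.

Lemma dyadic_extension_dyadic x : dyadic x -> dyadic_extension x = f x.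
Proof.
move=> xd; apply/cvg_lim => //; apply: cvg_near_cst.
by apply: filterS (dyadic_floor_id xd) => n /= ->.
Qed.

Lemma dyadic_extension_modulus x y : unit_cube x -> unit_cube y ->
  `|dyadic_extension x - dyadic_extension y| <= K * psi (enorm (x - y)).
Proof.
(* Continuity of [psi] is available only at positive radii. For equal points, [f_mod] at a single
   dyadic point gives [0 <= K * psi 0]. *)
move=> xc yc; have [<-|xy] := eqVneq x y.
  rewrite subrr normr0; have xd := dyadic_dyadic_floor 0 x.
  by have := f_mod xd xd; rewrite !subrr normr0 enorm0.
apply: (@ler_cvg_to nat \oo _ R
  (fun n => `|f (dyadic_floor n x) - f (dyadic_floor n y)|)
  (fun n => K * psi (enorm (dyadic_floor n x - dyadic_floor n y)))).
- by apply: cvg_norm; apply: cvgB; exact: cvg_dyadic_extension.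
- have r0 : 0 < enorm (x - y) by rewrite enorm_gt0// subr_eq0.
  apply: cvgMr; apply: (continuous_cvg _ (psi_cont r0)).
  exact: cvg_enorm_floor.
- by apply: nearW => n; apply: f_mod; exact: dyadic_dyadic_floor.
Qed.

Section modulus_continuity.
Variable g : 'rV[R]_d -> H.
Hypothesis g_mod : forall x y, unit_cube x -> unit_cube y ->
  `|g x - g y| <= K * psi (enorm (x - y)).

Lemma cvg_modulus_floor x : unit_cube x ->
  g (dyadic_floor n x) @[n --> \oo] --> g x.
Proof.
move=> xc; apply/cvgrPdist_lt => e e0.
have [N hN] := modulus_floor_small e0; exists N => // n /= Nn.
have fc := dyadic_cube (dyadic_dyadic_floor n x).
apply: (le_lt_trans (g_mod xc fc)); apply: (hN n) => // i.
by have /andP[? ?] := dyadic_floor_bounds n i xc; rewrite ger0_norm// ltW.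
Qed.

Lemma modulus_continuous : {within @unit_cube R d, continuous g}.
Proof.
apply/subspace_continuousP => x xc; apply/cvgrPdist_lt => e e0.
have [r0 r00 hr0] := modulus_small e0.
(* Balls are taken in the sup norm; the radius [r0 / d] keeps the Euclidean distance within [r0]. *)
apply/nbhs_ballP; exists (r0 / d%:R); first by rewrite /= divr_gt0 ?ltr0n.
move=> y [_ xy] yc; apply: (le_lt_trans (g_mod xc yc)); apply: hr0.
  exact: enorm_ge0.
have -> : r0 = d%:R * (r0 / d%:R) by rewrite mulrC divfK// pnatr_eq0 -lt0n.
apply: enorm_le => //; first by rewrite divr_ge0// ltW.
by move=> i; rewrite coordB ltW//; exact: xy.
Qed.

End modulus_continuity.

End extension.
End chaining.

(** * Suprema over the time interval *)

Section sup01.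
Variable R : realType.
Implicit Types f g : R -> \bar R.
Local Open Scope ereal_scope.

Lemma le_sup01 f t : t \in `[0%R, 1%R] -> f t <= sup01 f.
Proof. by move=> t01; apply: ereal_sup_ubound; exists t. Qed.

Lemma sup01_le f M : (forall t, t \in `[0%R, 1%R] -> f t <= M) -> sup01 f <= M.
Proof. by move=> fM; apply: ge_ereal_sup => _ [t t01 <-]; exact: fM. Qed.

Lemma zero_in01 : (0 : R)%R \in `[0%R, 1%R].
Proof. by rewrite in_itv/= lexx ler01. Qed.

Lemma sup01_ge0 f : (forall t, 0 <= f t) -> 0 <= sup01 f.
Proof. by move=> f0; apply: le_trans (f0 _) (le_sup01 f zero_in01). Qed.

Lemma eq_sup01 f g : (forall t, t \in `[0%R, 1%R] -> f t = g t) ->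
  sup01 f = sup01 g.
Proof.
move=> fg; apply/le_anti/andP; split; apply: sup01_le => t t01.
  by rewrite fg//; exact: le_sup01.
by rewrite -fg//; exact: le_sup01.
Qed.

Lemma sup01Zl f (r : R) : (0 <= r)%R -> sup01 (fun t => r%:E * f t) = r%:E * sup01 f.
Proof.
move=> r0; rewrite /sup01 -ereal_supZl//.
  by congr ereal_sup; rewrite -image_comp.
by apply/set0P; exists (f 0%R); exists 0%R => //; exact: zero_in01.
Qed.

End sup01.

Lemma continuous_powR_comp (R : realType) (phi : R -> R) (p r : R) :
  {for r, continuous phi} -> 0 < phi r ->
  {for r, continuous (fun x => phi x `^ p)}.
Proof.
move=> phic phi0; apply: (@continuous_comp _ _ _ phi (fun y : R => y `^ p)) => //.
apply: differentiable_continuous; apply/derivable1_diffP.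
by apply: derivable_powR; rewrite in_itv/= phi0.
Qed.

(** * The seminorm as a countable supremum over dyadic pairs *)

Section seminorm_sup.
Variables (R : realType) (d : nat) (H : completeNormedModType R).
Variables (phi : R -> R) (alpha gamma : R).
Hypothesis phi_gt0 : forall r : R, 0 < r -> 0 < phi r.
Hypothesis phi_cont : forall r : R, 0 < r -> {for r, continuous phi}.
Hypothesis gamma_gt0 : 0 < gamma.
Implicit Types (g : R -> 'rV[R]_d -> H) (x y : 'rV[R]_d).

(** Pairs are coded by naturals so that measurability follows from that of a supremum of a sequence.
    The weight stands outside the time supremum, which isolates the increment whose measurability is
    assumed. Equal points and invalid codes give 0, harmless in a supremum of nonnegative terms. *)
Definition dyadic_pair_sup (n : nat) g : \bar R :=
  if unpickle n is Some (m, a, a') then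
    let x := dyadic_pt R m (a : {ffun 'I_d -> nat}) in
    let y := dyadic_pt R m (a' : {ffun 'I_d -> nat}) in
    if x == y then 0%E
    else ((phi (enorm (x - y)) `^ (- (alpha * gamma)))%:E *
      sup01 (fun t => (`|g t x - g t y| `^ gamma)%:E))%E
  else 0%E.

Lemma quotient_powR x y (h : H) : x != y ->
  (`|h| / phi (enorm (x - y)) `^ alpha) `^ gamma =
  phi (enorm (x - y)) `^ (- (alpha * gamma)) * `|h| `^ gamma.
Proof.
move=> xy; have p0 : 0 < phi (enorm (x - y)).
  by apply: phi_gt0; rewrite enorm_gt0// subr_eq0.
rewrite powRM// ?invr_ge0 ?powR_ge0// mulrC; congr (_ * _).
by rewrite -powRN -powRrM mulNr.
Qed.

Lemma dyadic_pair_supE m (a a' : {ffun 'I_d -> nat}) g :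
  dyadic_pt R m a != dyadic_pt R m a' ->
  dyadic_pair_sup (pickle (m, a, a')) g =
  sup01 (fun t => ((`|g t (dyadic_pt R m a) - g t (dyadic_pt R m a')| /
    phi (enorm (dyadic_pt R m a - dyadic_pt R m a')) `^ alpha) `^ gamma)%:E).
Proof.
move=> xy; rewrite /dyadic_pair_sup pickleK (negbTE xy) -sup01Zl ?powR_ge0//.
by apply: eq_sup01 => t _; rewrite quotient_powR// EFinM.
Qed.

Lemma dyadic_pair_sup_ge0 n g : (0 <= dyadic_pair_sup n g)%E.
Proof.
rewrite /dyadic_pair_sup; case: unpickle => [[[m a] a']|//] /=.
case: ifP => // _; apply: mule_ge0; first by rewrite lee_fin powR_ge0.
by apply: sup01_ge0 => t; rewrite lee_fin powR_ge0.
Qed.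

Lemma phi_seminorm_ge0 f : (1 <= d)%N -> (0 <= @phi_seminorm R H d phi alpha f)%E.
Proof.
(* Over an empty set of pairs the supremum would be [-oo]; for [d >= 1] the all-ones vector and 0
   form an admissible pair. *)
move=> d1; pose x : 'rV[R]_d := \row_i 1.
apply: (@le_trans _ _ (`|f x - f 0| / phi (enorm (x - 0)) `^ alpha)%:E).
  by rewrite lee_fin divr_ge0// powR_ge0.
apply: ereal_sup_ubound; exists (x, 0) => //; split => /=.
- by move=> i; rewrite mxE in_itv/= ler01 lexx.
- by move=> i; rewrite mxE in_itv/= ler01 lexx.
- apply/eqP => /rowP/(_ (Ordinal d1)); rewrite !mxE.
  by apply/eqP; rewrite oner_eq0.
Qed.

(** Dyadic pairs are admissible, which gives one inequality. Conversely, for [x != y] the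
    projections are eventually distinct and their quotients converge to the quotient at [x] and [y],
    as [phi] is continuous and positive at a positive radius. *)
Lemma sup_phi_seminormE g : (1 <= d)%N ->
  (forall t x, t \in `[0, 1] -> unit_cube x ->
    g t (dyadic_floor n x) @[n --> \oo] --> g t x) ->
  sup01 (fun t => (phi_seminorm phi alpha (g t) `^ gamma)%E) =
  esups (fun n => dyadic_pair_sup n g) 0.
Proof.
move=> d1 gc; apply/le_anti/andP; split; last first.
  apply: ge_ereal_sup => _ [n _ <-]; rewrite /dyadic_pair_sup.
  case E : unpickle => [[[m a] a']|] /=; last first.
    by apply: sup01_ge0 => t; exact: poweR_ge0.
  case: ifPn => xy; first by apply: sup01_ge0 => t; exact: poweR_ge0.
  rewrite -sup01Zl ?powR_ge0//; apply: sup01_le => t t01.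
  rewrite -EFinM -quotient_powR//.
  apply: le_trans (le_sup01 _ t01); rewrite -poweR_EFin.
  apply: gt0_ler_poweR; rewrite ?(ltW gamma_gt0) ?in_itv/= ?leey ?andbT//.
  - by rewrite lee_fin divr_ge0// powR_ge0.
  - exact: phi_seminorm_ge0.
  apply: ereal_sup_ubound.
  exists (dyadic_pt R m a, dyadic_pt R m a') => //=.
  by split => //=; exact: dyadic_pt_cube.
apply: sup01_le => t t01; set S := esups _ _.
have S0 : (0 <= S)%E.
  apply: (le_trans (dyadic_pair_sup_ge0 0 g)).
  by apply: ereal_sup_ubound; exists 0%N.
rewrite -(poweRe1 S0) -(mulVf (lt0r_neq0 gamma_gt0)) poweRrM.
apply: gt0_ler_poweR; rewrite ?(ltW gamma_gt0) ?in_itv/= ?leey ?andbT ?poweR_ge0//.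
  exact: phi_seminorm_ge0.
apply: ge_ereal_sup => _ [[x y] /= [xc yc xy] <-].
pose q x y := `|g t x - g t y| / phi (enorm (x - y)) `^ alpha.
have q0 u v : 0 <= q u v by rewrite divr_ge0// powR_ge0.
have r0 : 0 < enorm (x - y) by rewrite enorm_gt0// subr_eq0.
have qd n : dyadic_floor n x != dyadic_floor n y ->
    ((q (dyadic_floor n x) (dyadic_floor n y))%:E <= S `^ gamma^-1)%E.
  move=> fxy; rewrite -[_%:E]poweRe1 ?lee_fin//.
  rewrite -(mulfV (lt0r_neq0 gamma_gt0)) poweRrM.
  apply: gt0_ler_poweR;
    rewrite ?invr_ge0 ?(ltW gamma_gt0) ?in_itv/= ?leey ?andbT ?poweR_ge0//.
    by rewrite lee_fin powR_ge0.
  pose a := [ffun i => Num.truncn (2 ^+ n * x ord0 i)].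
  pose a' := [ffun i => Num.truncn (2 ^+ n * y ord0 i)].
  have ea : dyadic_floor n x = dyadic_pt R n a.
    by apply/rowP => i; rewrite !mxE ffunE.
  have ea' : dyadic_floor n y = dyadic_pt R n a'.
    by apply/rowP => i; rewrite !mxE ffunE.
  apply: (@le_trans _ _ (dyadic_pair_sup (pickle (n, a, a')) g)); last first.
    by apply: ereal_sup_ubound; exists (pickle (n, a, a')).
  rewrite dyadic_pair_supE -?ea -?ea'//.
  exact: (le_sup01 (fun t => ((`|g t (dyadic_floor n x) - g t (dyadic_floor n y)| /
    phi (enorm (dyadic_floor n x - dyadic_floor n y)) `^ alpha) `^ gamma)%:E)).
have cphi : phi (enorm (dyadic_floor n x - dyadic_floor n y)) `^ alpha
    @[n --> \oo] --> phi (enorm (x - y)) `^ alpha.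
  have c := @continuous_powR_comp _ _ alpha _ (phi_cont r0) (phi_gt0 r0).
  exact: (continuous_cvg _ c (cvg_enorm_floor xc yc)).
have cq : q (dyadic_floor n x) (dyadic_floor n y) @[n --> \oo] --> q x y.
  apply: cvgM; first by apply: cvg_norm; apply: cvgB; exact: gc.
  by apply: cvgV => //; rewrite gt_eqF// powR_gt0// phi_gt0.
have neq : \forall n \near \oo, dyadic_floor n x != dyadic_floor n y.
  have /cvgrPdist_lt/(_ _ r0) := cvg_enorm_floor xc yc.
  apply: filterS => n; apply: contraTneq => ->.
  by rewrite subrr enorm0 subr0 gtr0_norm// ltxx.
(* The bound may be [+oo], where nothing is left to prove; a real bound passes to the limit. *)
case: (S `^ gamma^-1)%E (poweR_ge0 S gamma^-1) qd => [s _|_|//] qd.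
- rewrite lee_fin; apply: (cvgr_to_le cq).
  by apply: filterS neq => n /qd; rewrite lee_fin.
- by rewrite leey.
Qed.

End seminorm_sup.

(** * Borel measurability of pointwise limits *)

Section borel_limits.
Variables (R : realType) (H : completeNormedModType R).
Variables (disp : measure_display) (T : measurableType disp).

Lemma open_dist_lt (A : set H) (e : R) :
  open [set z | exists2 y, A y & `|z - y| < e].
Proof.
rewrite (_ : mkset _ = \bigcup_(y in A) ball y e).
  by apply: bigcup_open => y _; exact: ball_open.
apply/seteqP; split => z /=.
  by move=> [y Ay zy]; exists y => //; rewrite -ball_normE/= distrC.
by move=> [y Ay]; rewrite -ball_normE/= distrC; exists y.
Qed.

(* An open set V is the union over k of the sets of points at distance at least
   1/(k+1) from its complement. *)
Lemma measurable_fun_cvg_borel (F : nat -> T -> H) (f : T -> H) :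
  (forall n, measurable_fun [set: T] (F n : T -> g_sigma_algebraType (@open H))) ->
  (forall w, F n w @[n --> \oo] --> f w) ->
  measurable_fun [set: T] (f : T -> g_sigma_algebraType (@open H)).
Proof.
move=> mF Ff.
apply: (@measurability _ _ T (g_sigma_algebraType (@open H)) _ f (@open H)) => //.
move=> _ [V openV <-]; rewrite setTI.
pose W (k : nat) := [set z : H | exists2 y, ~ V y & `|z - y| < k.+1%:R^-1].
(* The limit lies in [V] exactly when, for some [k], the sequence eventually stays out of [W k]. *)
have -> : f @^-1` V = \bigcup_k \bigcup_N \bigcap_(n in [set n | (N <= n)%N])
    ~` (F n @^-1` W k).
  apply/seteqP; split => w /=.
    move=> Vfw; have := openV; rewrite openE => /(_ _ Vfw) /nbhs_ballP[e /= e0 eV].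
    have [k ke] : exists k, k.+1%:R^-1 < e / 2.
      have e20 : 0 < e / 2 by rewrite divr_gt0.
      exists (Num.truncn (e / 2)^-1); rewrite invf_plt ?posrE ?ltr0n//.
      by have /truncn_itv/andP[] : 0 <= (e / 2)^-1 by rewrite invr_ge0 ltW.
    have /cvgrPdist_lt/(_ (e / 2)) := Ff w.
    rewrite divr_gt0// => /(_ isT)[N _ hN].
    exists k => //; exists N => // n /= Nn [y nVy zy]; apply: nVy; apply: eV.
    rewrite -ball_normE/= (le_lt_trans (ler_distD (F n w) _ _))//.
    rewrite [ltRHS]splitr ltrD//; first exact: hN.
    exact: lt_trans zy ke.
  move=> [k _ [N _ hN]]; apply: contrapT => nV.
  have /cvgrPdist_lt/(_ k.+1%:R^-1) := Ff w.
  rewrite invr_gt0 ltr0n => /(_ isT)[M _ hM].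
  apply: (hN (maxn M N)); first by rewrite /= leq_maxr.
  exists (f w) => //; rewrite distrC; apply: hM; exact: leq_maxl.
apply: bigcup_measurable => k _; apply: bigcup_measurable => N _.
apply: bigcap_measurableType => n _; apply: measurableC.
rewrite -[X in measurable X]setTI; apply: mF => //.
by apply: sub_sigma_algebra; exact: open_dist_lt.
Qed.

End borel_limits.

Lemma measurable_fun_if_set (d1 d2 : measure_display) (T1 : measurableType d1)
    (T2 : measurableType d2) (A : set T1) (g h : T1 -> T2) :
  measurable A -> measurable_fun [set: T1] g -> measurable_fun [set: T1] h ->
  measurable_fun [set: T1] (fun w => if w \in A then g w else h w).
Proof.
move=> mA mg mh; apply: measurable_fun_ifT => //.
apply: (measurable_fun_bool true); rewrite setTI (_ : _ @^-1` _ = A)//.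
by apply/seteqP; split => w; [exact: set_mem|exact: mem_set].
Qed.

(* For gamma < 1 the bound is x ^ (1 / gamma) <= x; for 1 <= gamma it is the
   geometric mean p ^ (theta (1 - 1 / gamma)) * x ^ (1 / gamma) <= x + p ^ theta,
   where x = p ^ (q - 1) * xi / V. *)
Lemma chaining_interpolation (R : realType) (gamma theta p V xi : R) :
  0 < gamma -> 0 < p -> 0 < V -> 0 <= xi ->
  let q := theta * Num.min gamma 1 in
  p `^ (q - 1) * xi / V <= 1 ->
  xi `^ gamma^-1 <= p `^ (gamma^-1 - theta) *
    (V `^ gamma^-1 * (p `^ (q - 1) * xi / V + p `^ q)).
Proof.
move=> g0 p0 V0 xi0 q; set x := _ / V => x1.
have x0 : 0 <= x by rewrite divr_ge0 ?mulr_ge0 ?powR_ge0// ltW.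
have gV0 : 0 < gamma^-1 by rewrite invr_gt0.
have -> : xi = V * (p `^ (1 - q) * x).
  have pq : p `^ (1 - q) * p `^ (q - 1) = 1.
    rewrite -powRD ?addrA ?subrK ?subrr ?powRr0//.
    by rewrite (gt_eqF p0) implybT.
  have -> : V * (p `^ (1 - q) * x) = p `^ (1 - q) * p `^ (q - 1) * xi.
    by rewrite /x; field; rewrite gt_eqF.
  by rewrite pq mul1r.
have px0 : 0 <= p `^ (1 - q) * x by apply: mulr_ge0 => //; exact: powR_ge0.
rewrite (powRM _ (ltW V0) px0) [leRHS]mulrCA.
rewrite ler_wpM2l ?powR_ge0//.
rewrite powRM ?powR_ge0// -powRrM.
have [g1|g1] := ltP gamma 1.
  have qE : q = theta * gamma by rewrite /q min_l// ltW.
  have -> : (1 - q) / gamma = gamma^-1 - theta.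
    by rewrite qE mulrBl mul1r mulfK ?gt_eqF.
  rewrite ler_wpM2l ?powR_ge0//.
  apply: (@le_trans _ _ x); last by rewrite lerDl powR_ge0.
  have [->|xn0] := eqVneq x 0; first by rewrite powR0 ?gt_eqF.
  rewrite -[leRHS]powRr1//; apply: ger_powR.
    by rewrite lt_neqAle eq_sym xn0 x0.
  by rewrite -[leLHS]invr1 lef_pV2 ?posrE// ltW.
have qE : q = theta by rewrite /q min_r// mulr1.
have s1 : 0 <= 1 - gamma^-1 by rewrite subr_ge0 invf_le1.
have -> : (1 - q) / gamma = (gamma^-1 - theta) + theta * (1 - gamma^-1).
  by rewrite qE; field; rewrite gt_eqF.
rewrite powRD; last by rewrite (gt_eqF p0) implybT.
rewrite -mulrA ler_wpM2l ?powR_ge0// qE powRrM.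
have pt0 : 0 < p `^ theta by rewrite powR_gt0.
(* Each base is at most [x + p ^ theta], and the two exponents are nonnegative and add up to 1. *)
apply: (@le_trans _ _ ((x + p `^ theta) `^ (1 - gamma^-1) *
    (x + p `^ theta) `^ gamma^-1)).
  have xp0 : 0 <= x + p `^ theta by rewrite addr_ge0// ltW.
  apply: ler_pM; rewrite ?powR_ge0//; apply: ge0_ler_powR;
    by rewrite ?nnegrE ?lerDl ?lerDr// ltW.
rewrite -powRD; first by rewrite subrK powRr1// addr_ge0// ltW.
by rewrite gt_eqF ?implybT// ltr_wpDl.
Qed.

(** * Positivity and doubling of [phi] from the ratio condition *)

Section doubling.
Variables (R : realType) (phi : R -> R) (lambda : R).
Hypothesis phi_ge0 : forall r : R, 0 < r -> 0 <= phi r.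
Hypothesis phi_nd : forall r s : R, 0 < r -> r <= s -> phi r <= phi s.
Hypothesis lambda_ge1 : 1 <= lambda.
Hypothesis ratio : \forall n \near \oo,
  lambda^-1 <= phi (2 ^- n) / phi (2 ^- n.+1) <= lambda.

Let half_gt0 n : (0 : R) < 2 ^- n. Proof. by rewrite invr_gt0 exprn_gt0. Qed.

(** A zero value would make the ratio 0, below the positive number [lambda^-1]. *)
Lemma ratio_gt0 : \forall n \near \oo, 0 < phi (2 ^- n).
Proof.
apply: filterS ratio => n /andP[h _]; rewrite lt_neqAle phi_ge0// andbT.
apply/eqP => e; move: h; rewrite -e mul0r leNgt invr_gt0.
by rewrite (lt_le_trans ltr01).
Qed.

Lemma ratio_phi_gt0 r : 0 < r -> 0 < phi r.
Proof.
move=> r0; have /cvgrPdist_lt/(_ _ r0) := @cvg_half_pow R.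
move=> /(filterI ratio_gt0)[n _ /(_ n (leqnn n))/= [p0]].
rewrite sub0r normrN ger0_norm ?(ltW (half_gt0 n))// => nr.
exact: (lt_le_trans p0 (phi_nd (half_gt0 n) (ltW nr))).
Qed.

(** With [D <= 2 ^ k], the left side is at most [phi (2 ^- (m - k))], and [k] ratio steps cost
    [lambda ^ k] once [m - k] is past the threshold [N]. The finitely many coarser levels are
    covered by [phi D / phi (2 ^- (N + k))]. *)
Lemma ratio_doubling (D : R) : 0 < D ->
  exists2 K, 0 <= K & forall m, phi (D * 2 ^- m) <= K * phi (2 ^- m).
Proof.
move=> D0; have [N _ hN] := ratio.
have step n k : (N <= n)%N -> phi (2 ^- n) <= lambda ^+ k * phi (2 ^- (n + k)).
  move=> Nn; elim: k => [|k IHk]; first by rewrite addn0 expr0 mul1r.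
  apply: (le_trans IHk); rewrite exprSr -mulrA ler_wpM2l//.
    by rewrite exprn_ge0// (le_trans ler01).
  rewrite addnS -ler_pdivrMr ?ratio_phi_gt0//.
  by have /andP[] := hN (n + k)%N (leq_trans Nn (leq_addr _ _)).
have [k Dk] : exists k, D <= 2 ^+ k.
  exists (Num.truncn D).+1; have /truncn_itv/andP[_ /ltW/le_trans] := ltW D0.
  by apply; rewrite -natrX ler_nat ltnW// ltn_expl.
have pNk := ratio_phi_gt0 (half_gt0 (N + k)).
have K0 : 0 <= phi D / phi (2 ^- (N + k)).
  by rewrite divr_ge0// ltW// ratio_phi_gt0.
have l0 : 0 <= lambda ^+ k by rewrite exprn_ge0// (le_trans ler01).
exists (lambda ^+ k + phi D / phi (2 ^- (N + k))); first by rewrite addr_ge0.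
move=> m; have pm := ratio_phi_gt0 (half_gt0 m); rewrite mulrDl.
have [mNk|Nkm] := ltnP m (N + k).
  apply: (@le_trans _ _ (phi D / phi (2 ^- (N + k)) * phi (2 ^- m))); last first.
    by rewrite lerDr mulr_ge0// ltW.
  apply: (@le_trans _ _ (phi D)).
    apply: phi_nd; first by rewrite mulr_gt0.
    by rewrite ler_piMr ?(ltW D0)// invf_le1 ?exprn_gt0// exprn_ege1// ler1n.
  rewrite mulrAC ler_pdivlMr// ler_wpM2l ?(ltW (ratio_phi_gt0 D0))//.
  apply: phi_nd => //; rewrite lef_pV2 ?posrE ?exprn_gt0//.
  by rewrite ler_weXn2l ?ler1n// ltnW.
apply: (@le_trans _ _ (lambda ^+ k * phi (2 ^- m))); last first.
  by rewrite lerDl mulr_ge0// ltW.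
have km : (k <= m)%N by rewrite (leq_trans _ Nkm)// leq_addl.
apply: le_trans (_ : phi (2 ^- (m - k)) <= _).
  apply: phi_nd; first by rewrite mulr_gt0.
  rewrite -{1}(subnK km) exprD invfM mulrCA ler_piMr ?(ltW (half_gt0 _))//.
  by rewrite ler_pdivrMr ?exprn_gt0// mul1r.
by have := step (m - k)%N k; rewrite subnK//; apply; rewrite leq_subRL// addnC.
Qed.

End doubling.

(** * Dyadic energy and its expectation *)

Section energy.
Variables (R : realType) (H : completeNormedModType R) (d : nat).
Hypothesis d_gt0 : (1 <= d)%N.
Variables (disp : measure_display) (T : measurableType disp).
Variables (P : probability T R) (X : R -> 'rV[R]_d -> T -> H).
Variables (phi : R -> R) (gamma C theta : R).
Hypothesis phi_at0 : phi 0 = 0.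
Hypothesis phi_gt0 : forall r : R, 0 < r -> 0 < phi r.
Hypothesis phi_nd : forall r s : R, 0 < r -> r <= s -> phi r <= phi s.
Hypothesis phi_cont : forall r : R, 0 < r -> {for r, continuous phi}.
Hypothesis phi_lim0 : phi r @[r --> 0^'+] --> 0.
Hypothesis gamma_gt0 : 0 < gamma.
Hypothesis theta_lt : theta < gamma^-1.
Hypothesis C_ge0 : 0 <= C.

Definition sup_incr x y w : \bar R :=
  sup01 (fun t => (`|X t x w - X t y w| `^ gamma)%:E).

Hypothesis sup_incr_measurable : forall x y, unit_cube x -> unit_cube y ->
  measurable_fun [set: T] (sup_incr x y).
Hypothesis sup_incr_moment : forall x y, unit_cube x -> unit_cube y ->
  (\int[P]_w sup_incr x y w
    <= (C * enorm (x - y) ^+ d * phi (enorm (x - y)))%:E)%E.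

Lemma sup_incr_ge0 x y w : (0 <= sup_incr x y w)%E.
Proof. by apply: sup01_ge0 => t; rewrite lee_fin powR_ge0. Qed.

Lemma phi_nd0 (r s : R) : 0 <= r -> r <= s -> phi r <= phi s.
Proof.
rewrite le_eqVlt => /predU1P[<-|r0]; last exact: phi_nd.
by rewrite le_eqVlt => /predU1P[<-//|s0]; rewrite phi_at0 ltW// phi_gt0.
Qed.

(* Neighbours at level m are indexed by a grid point and an offset, so that
   counting them needs no injectivity argument; the offset e stands for e - 4. *)
Definition neighbor_index m : finType :=
  ({ffun 'I_d -> 'I_(2 ^ m).+1} * {ffun 'I_d -> 'I_9})%type.

Definition neighbor_fst m (p : neighbor_index m) : 'rV[R]_d :=
  dyadic_pt R m (fun i => p.1 i).

(** Truncated subtraction and the clipping in [dyadic_pt] bring an out-of-range neighbour back to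
    the boundary of the grid, which does not lengthen the offset. *)
Definition neighbor_snd m (p : neighbor_index m) : 'rV[R]_d :=
  dyadic_pt R m (fun i => (p.1 i + p.2 i - 4)%N).

Definition level_energy m w : \bar R :=
  (\sum_(p : neighbor_index m) sup_incr (neighbor_fst p) (neighbor_snd p) w)%E.

Lemma level_energy_ge0 m w : (0 <= level_energy m w)%E.
Proof. by apply: sume_ge0 => p _; exact: sup_incr_ge0. Qed.

Lemma level_energy_measurable m : measurable_fun [set: T] (level_energy m).
Proof.
by apply: emeasurable_sum => p; apply: sup_incr_measurable;
  exact: dyadic_pt_cube.
Qed.

Lemma dyadic_pt_distE m (a a' : 'I_d -> nat) i :
  `|dyadic_pt R m a ord0 i - dyadic_pt R m a' ord0 i| =
  `|(minn (a i) (2 ^ m))%:R - (minn (a' i) (2 ^ m))%:R| * 2 ^- m.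
Proof.
by rewrite !mxE -mulrBl normrM [X in _ * X]ger0_norm// invr_ge0 exprn_ge0.
Qed.

Lemma neighbor_dist m (p : neighbor_index m) i :
  `|neighbor_fst p ord0 i - neighbor_snd p ord0 i| <= 4 * 2 ^- m.
Proof.
rewrite dyadic_pt_distE ler_wpM2r ?invr_ge0 ?exprn_ge0//.
have clip (u e k : nat) : (e < 9)%N -> (minn u k <= minn (u + e - 4) k + 4 /\
  minn (u + e - 4) k <= minn u k + 4)%N by lia.
have [] := clip (p.1 i) _ (2 ^ m)%N (ltn_ord (p.2 i)).
rewrite -!(ler_nat R) !natrD => ? ?.
by rewrite ler_norml; lra.
Qed.

(** Every increment used in chaining is thereby one of the summands of [level_energy]. *)
Lemma neighbor_exists m (a a' : 'I_d -> nat) :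
  (forall i, `|dyadic_pt R m a ord0 i - dyadic_pt R m a' ord0 i| <=
    4 * 2 ^- m) ->
  exists p : neighbor_index m,
    dyadic_pt R m a = neighbor_fst p /\ dyadic_pt R m a' = neighbor_snd p.
Proof.
move=> aa'; pose u i := minn (a i) (2 ^ m); pose v i := minn (a' i) (2 ^ m).
have uv i : (u i <= v i + 4 /\ v i <= u i + 4)%N.
  have := aa' i; rewrite dyadic_pt_distE ler_pM2r ?invr_gt0 ?exprn_gt0//.
  rewrite ler_norml -/(u i) -/(v i) => /andP[? ?].
  by split; rewrite -(ler_nat R) natrD; lra.
have um i : (u i <= 2 ^ m)%N by exact: geq_minr.
have vm i : (v i <= 2 ^ m)%N by exact: geq_minr.
(* The shifted offset lies between 0 and 8 because the clipped indices differ by at most 4. *)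
exists ([ffun i => inord (u i)], [ffun i => inord (v i + 4 - u i)]).
split; apply/rowP => i; rewrite !mxE /= !ffunE !inordK ?ltnS//.
- by rewrite -/(u i) (minn_idPl (um i)).
- rewrite -/(v i); congr (_%:R / _); have := uv i; have := vm i.
  by move: (u i) (v i) (2 ^ m)%N => ? ? ?; lia.
- by have := uv i; lia.
Qed.

Variable K : R.
Hypothesis K_ge0 : 0 <= K.
Hypothesis phi_doubling : forall m, phi (d%:R * 4 * 2 ^- m) <= K * phi (2 ^- m).

Let half_gt0 n : (0 : R) < 2 ^- n. Proof. by rewrite invr_gt0 exprn_gt0. Qed.

(* 72 = 2 * 9 * 4: per coordinate there are at most 2 * 2^m grid values and 9
   offsets, and neighbours are at distance at most 4 * 2^-m. *)
Definition energy_const : R := (d%:R * 72) ^+ d * C * K.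

(** The power [d] of the distance in the moment bound cancels the growth [2 ^ (m * d)] of the number
    of pairs; doubling brings the argument of [phi] back to [2 ^- m]. *)
Lemma level_energy_moment m :
  (\int[P]_w level_energy m w <= (energy_const * phi (2 ^- m))%:E)%E.
Proof.
rewrite ge0_integral_sum//; last 2 first.
- by move=> p; apply: sup_incr_measurable; exact: dyadic_pt_cube.
- by move=> p w _; exact: sup_incr_ge0.
pose M := C * (d%:R * 4 * 2 ^- m) ^+ d * (K * phi (2 ^- m)).
have pm := ltW (phi_gt0 (half_gt0 m)).
have D0 : 0 <= d%:R * 4 * 2 ^- m :> R by rewrite mulr_ge0// ltW.
apply: (@le_trans _ _ (\sum_(p : neighbor_index m) M%:E)%E).
  apply: lee_sum => p _.
  have fc : unit_cube (neighbor_fst p) by exact: dyadic_pt_cube.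
  have sc : unit_cube (neighbor_snd p) by exact: dyadic_pt_cube.
  apply: (le_trans (sup_incr_moment fc sc)).
  have le_e : enorm (neighbor_fst p - neighbor_snd p) <= d%:R * 4 * 2 ^- m.
    rewrite -mulrA; apply: enorm_le => // i.
    by rewrite coordB neighbor_dist.
  have e0 := enorm_ge0 (neighbor_fst p - neighbor_snd p).
  rewrite lee_fin; apply: ler_pM.
  - by rewrite mulr_ge0// exprn_ge0.
  - by rewrite -phi_at0 phi_nd0.
  - by rewrite ler_wpM2l// lerXn2r ?nnegrE.
  - by apply: le_trans (phi_doubling m); exact: phi_nd0.
rewrite sumEFin lee_fin sumr_const card_prod !card_ffun !card_ord.
rewrite -[leLHS]mulr_natl natrM !natrX.
rewrite (_ : _ * M = ((2 ^ m).+1%:R * 9 * (d%:R * 4 * 2 ^- m)) ^+ d * C * K *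
  phi (2 ^- m)); last first.
  by rewrite /M !exprMn; move: (_.+1%:R) (_^-1) => u v; ring.
rewrite /energy_const -!mulrA ler_wpM2r ?mulr_ge0//.
rewrite lerXn2r ?nnegrE ?mulr_ge0 ?(ltW (half_gt0 m))//.
have : (2 ^ m).+1%:R * 2 ^- m <= 2 :> R.
  rewrite ler_pdivrMr ?exprn_gt0// -natrX -natrM ler_nat mul2n -addnn.
  by rewrite -addn1 leq_add2l expn_gt0.
have : 0 <= d%:R :> R by [].
by move: (_.+1%:R) (2 ^- m) (d%:R : R) => a b c c0 ab; nra.
Qed.

Let q : R := theta * Num.min gamma 1.
Hypothesis phi_summable : (\sum_(0 <= m <oo) (phi (2 ^- m) `^ q)%:E < +oo)%E.

Definition energy w : \bar R :=
  (\sum_(0 <= m <oo) ((phi (2 ^- m) `^ (q - 1))%:E * level_energy m w))%E.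

Let term_ge0 m w :
  (0 <= (phi (2 ^- m) `^ (q - 1))%:E * level_energy m w)%E.
Proof. by rewrite mule_ge0 ?level_energy_ge0// lee_fin powR_ge0. Qed.

Lemma energy_ge0 w : (0 <= energy w)%E.
Proof. by apply: nneseries_ge0 => m _ _. Qed.

Let term_measurable m : measurable_fun [set: T]
  (fun w => (phi (2 ^- m) `^ (q - 1))%:E * level_energy m w)%E.
Proof. by apply: measurable_funeM; exact: level_energy_measurable. Qed.

Lemma energy_measurable : measurable_fun [set: T] energy.
Proof. exact: (@ge0_emeasurable_sum _ _ _ _ _ xpredT). Qed.

Lemma energy_moment : (\int[P]_w energy w < +oo)%E.
Proof.
rewrite integral_nneseries//.
have c0 : 0 <= energy_const by rewrite !mulr_ge0// exprn_ge0// mulr_ge0.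
apply: (@le_lt_trans _ _
    (\sum_(0 <= m <oo) (energy_const%:E * (phi (2 ^- m) `^ q)%:E))%E).
  apply: lee_nneseries => m _; first by move=> _; exact: integral_ge0.
  rewrite ge0_integralZl_EFin ?powR_ge0//; last 2 first.
  - by move=> w _; exact: level_energy_ge0.
  - exact: level_energy_measurable.
  have p0 := phi_gt0 (half_gt0 m).
  apply: (@le_trans _ _ ((phi (2 ^- m) `^ (q - 1))%:E *
      (energy_const * phi (2 ^- m))%:E)%E).
    by rewrite lee_wpmul2l ?lee_fin ?powR_ge0// level_energy_moment.
  rewrite -!EFinM lee_fin mulrCA ler_wpM2l//.
  rewrite -[X in _ * X](powRr1 (ltW p0)) -powRD ?subrK//.
  by rewrite (gt_eqF p0) implybT.
rewrite nneseriesZl; last by move=> m _; rewrite lee_fin powR_ge0.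
by rewrite lte_mul_pinfty.
Qed.

(** * Modulus of the paths where the energy is finite *)

Definition path_const : R :=
  2 * (1 + fine (\sum_(0 <= m <oo) (phi (2 ^- m) `^ q)%:E)%E).

(** The added 1 makes [energy + 1] a positive divisor even at zero energy. *)
Definition path_bound w : R := path_const * (fine (energy w) + 1) `^ gamma^-1.

Let phi_series_fin :
  (\sum_(0 <= m <oo) (phi (2 ^- m) `^ q)%:E)%E \is a fin_num.
Proof.
by rewrite ge0_fin_numE// nneseries_ge0// => m _ _; rewrite lee_fin powR_ge0.
Qed.

Lemma path_const_ge0 : 0 <= path_const.
Proof.
rewrite mulr_ge0// addr_ge0// fine_ge0// nneseries_ge0// => m _ _.
by rewrite lee_fin powR_ge0.
Qed.

Lemma path_bound_ge0 w : 0 <= path_bound w.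
Proof. by rewrite mulr_ge0 ?path_const_ge0 ?powR_ge0. Qed.

(** Interpolation is applied at each level with [p = phi (2 ^- m)], [V = energy + 1] and [xi] the
    level energy; its premise holds since each term of the energy series is at most the whole.
    Chaining then sums the levels. *)
Lemma path_modulus w t x y : (energy w < +oo)%E -> t \in `[0, 1] ->
  dyadic x -> dyadic y ->
  `|X t x w - X t y w| <=
  path_bound w * phi (enorm (x - y)) `^ (gamma^-1 - theta).
Proof.
move=> Uoo t01 xd yd.
have [<-|xy] := eqVneq x y.
  by rewrite subrr normr0 mulr_ge0 ?path_bound_ge0 ?powR_ge0.
have Ufin : energy w \is a fin_num by rewrite ge0_fin_numE// energy_ge0.
set u := fine (energy w); have u0 : 0 <= u by rewrite fine_ge0// energy_ge0.
have V0 : 0 < u + 1 by rewrite ltr_wpDl.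
have cp m : 0 < phi (2 ^- m) `^ (q - 1) by rewrite powR_gt0// phi_gt0.
have partial n : (\sum_(0 <= m < n)
    ((phi (2 ^- m) `^ (q - 1))%:E * level_energy m w) <= u%:E)%E.
  by rewrite fineK//; apply: nneseries_lim_ge.
have term m : ((phi (2 ^- m) `^ (q - 1))%:E * level_energy m w <= u%:E)%E.
  apply: le_trans (partial m.+1); rewrite big_nat_recr//= leeDr//.
  by apply: sume_ge0.
have Efin m : level_energy m w \is a fin_num.
  rewrite ge0_fin_numE ?level_energy_ge0// ltey; apply/eqP => E.
  by have := term m; rewrite E gt0_muley ?lte_fin.
pose xi m := fine (level_energy m w).
have xi0 m : 0 <= xi m by rewrite fine_ge0// level_energy_ge0.
have xiE m : (xi m)%:E = level_energy m w by rewrite fineK.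
pose b m := (u + 1) `^ gamma^-1 *
  (phi (2 ^- m) `^ (q - 1) * xi m / (u + 1) + phi (2 ^- m) `^ q).
have b0 m : 0 <= b m.
  rewrite mulr_ge0 ?powR_ge0// addr_ge0 ?powR_ge0// divr_ge0 ?(ltW V0)//.
  by rewrite mulr_ge0// ltW.
pose A := fine (\sum_(0 <= m <oo) (phi (2 ^- m) `^ q)%:E)%E.
(* Division by [u + 1] makes the weighted level energies sum to at most 1, and the remaining powers
   sum to at most [A]; the factor 2 in [path_const] comes from chaining. *)
have bsum n : \sum_(0 <= m < n) b m <= (u + 1) `^ gamma^-1 * (1 + A).
  rewrite -mulr_sumr ler_wpM2l ?powR_ge0// big_split/=; apply: lerD.
    rewrite -mulr_suml ler_pdivrMr// mul1r.
    apply: (@le_trans _ _ u); last by rewrite lerDl.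
    rewrite -lee_fin -sumEFin; apply: le_trans (partial n).
    by apply: lee_sum => m _; rewrite EFinM xiE.
  rewrite -lee_fin -sumEFin fineK//; apply: nneseries_lim_ge => m _ _.
  by rewrite lee_fin powR_ge0.
have incr m a a' : (forall i,
    `|dyadic_pt R m a ord0 i - dyadic_pt R m a' ord0 i| <= 4 * 2 ^- m) ->
    `|X t (dyadic_pt R m a) w - X t (dyadic_pt R m a') w| <=
    phi (2 ^- m) `^ (gamma^-1 - theta) * b m.
  move=> /neighbor_exists[p [-> ->]].
  apply: (@le_trans _ _ (xi m `^ gamma^-1)).
    rewrite -[leLHS]powRr1// -(mulfV (lt0r_neq0 gamma_gt0)) powRrM.
    apply: ge0_ler_powR; rewrite ?invr_ge0 ?(ltW gamma_gt0) ?nnegrE ?powR_ge0//.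
    rewrite -lee_fin xiE.
    apply: (@le_trans _ _ (sup_incr (neighbor_fst p) (neighbor_snd p) w)).
      exact: (le_sup01 (fun t =>
        (`|X t (neighbor_fst p) w - X t (neighbor_snd p) w| `^ gamma)%:E)).
    rewrite /level_energy (bigD1 p)//= leeDl// sume_ge0// => p' _.
    exact: sup_incr_ge0.
  apply: chaining_interpolation => //; first exact: phi_gt0.
  rewrite -/q ler_pdivrMr// mul1r -lee_fin EFinM xiE.
  by apply: (le_trans (term m)); rewrite lee_fin lerDl.
have psi_nd (r s : R) : 0 < r -> r <= s ->
    phi r `^ (gamma^-1 - theta) <= phi s `^ (gamma^-1 - theta).
  move=> r0 rs; apply: ge0_ler_powR; rewrite ?subr_ge0 ?(ltW theta_lt) ?nnegrE//.
  - by rewrite ltW// phi_gt0.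
  - by rewrite ltW// phi_gt0// (lt_le_trans r0).
  - exact: phi_nd.
have psi_ge0 (r : R) : 0 <= r -> 0 <= phi r `^ (gamma^-1 - theta).
  by rewrite powR_ge0.
have := @dyadic_chaining R d H (fun r => phi r `^ (gamma^-1 - theta))
  (fun x => X t x w) b psi_ge0 psi_nd b0 incr _ _ _ bsum xd yd xy.
move/le_trans; apply.
by rewrite /path_bound /path_const -/A -/u [_ `^ _ * (1 + A)]mulrC mulrA.
Qed.

Let psi (r : R) : R := phi r `^ (gamma^-1 - theta).

Lemma psi_small (e : R) : 0 < e ->
  exists2 r0 : R, 0 < r0 & forall r : R, 0 <= r -> r <= r0 -> psi r <= e.
Proof.
move=> e0; have a0 : 0 < gamma^-1 - theta by rewrite subr_gt0.
have d0 : 0 < e `^ (gamma^-1 - theta)^-1 by rewrite powR_gt0.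
have /cvgrPdist_lt/(_ _ d0)[/= r0 r00 hr0] := phi_lim0.
(* Halving turns the weak bound on [r] into the strict one that the neighbourhood requires. *)
exists (r0 / 2); first by rewrite divr_gt0.
move=> r; rewrite le_eqVlt => /predU1P[<- _|r_gt0 rr0].
  by rewrite /psi phi_at0 powR0 ?gt_eqF// ltW.
have rE : r < r0 by apply: (le_lt_trans rr0); rewrite ltr_pdivrMr// ltr_pMr// ltr1n.
have := hr0 r; rewrite /ball_/= !sub0r !normrN !gtr0_norm ?phi_gt0//.
move=> /(_ rE r_gt0)/ltW h.
rewrite -[leRHS](powRr1 (ltW e0)) -(mulVf (lt0r_neq0 a0)) powRrM.
by apply: ge0_ler_powR; rewrite ?(ltW a0) ?nnegrE ?powR_ge0// ltW// phi_gt0.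
Qed.

(** * The version: modulus, continuity and measurability *)

Definition finite_energy : set T := [set w | energy w \is a fin_num].

Lemma finite_energyP w : finite_energy w -> (energy w < +oo)%E.
Proof. by rewrite /finite_energy/= ge0_fin_numE ?energy_ge0. Qed.

Lemma finite_energy_measurable : measurable finite_energy.
Proof.
rewrite -[finite_energy]setTI; apply: emeasurable_fin_num => //.
exact: energy_measurable.
Qed.

Lemma finite_energy_ae : {ae P, forall w, finite_energy w}.
Proof.
have /(integrable_ae measurableT) : P.-integrable [set: T] energy.
  apply/integrableP; split; first exact: energy_measurable.
  under eq_integral do rewrite gee0_abs ?energy_ge0//.
  exact: energy_moment.
by apply: filterS => w; apply.
Qed.

(* Off [finite_energy] the version is constant in space; taking the value at the
   origin keeps the event "X and its version agree at x" measurable. *)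
Definition version (t : R) (x : 'rV[R]_d) (w : T) : H :=
  if w \in finite_energy then dyadic_extension (fun z => X t z w) x
  else X t 0 w.

(** The value 0 matches the constancy of the version off [finite_energy], so that the modulus holds
    at every outcome. *)
Definition version_bound (w : T) : R :=
  if w \in finite_energy then path_bound w else 0.

Lemma version_bound_ge0 w : 0 <= version_bound w.
Proof. by rewrite /version_bound; case: ifP => // _; exact: path_bound_ge0. Qed.

Let psi_cont (r : R) : 0 < r -> {for r, continuous psi}.
Proof.
by move=> r0; apply: continuous_powR_comp; [exact: phi_cont|exact: phi_gt0].
Qed.

Let path_mod w t : finite_energy w -> t \in `[0, 1] ->
  forall x y, dyadic x -> dyadic y ->
  `|X t x w - X t y w| <= path_bound w * psi (enorm (x - y)).
Proof. by move=> /finite_energyP gw t01 x y; exact: path_modulus. Qed.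

Lemma version_modulus w t x y : t \in `[0, 1] -> unit_cube x -> unit_cube y ->
  `|version t x w - version t y w| <= version_bound w * psi (enorm (x - y)).
Proof.
move=> t01 xc yc; rewrite /version /version_bound; case: ifPn => [/set_mem gw|_].
  exact: (dyadic_extension_modulus d_gt0 (path_bound_ge0 w) psi_small psi_cont
    (path_mod gw t01)).
by rewrite subrr normr0 mul0r.
Qed.

Lemma version_dyadic w t x : finite_energy w -> dyadic x ->
  version t x w = X t x w.
Proof.
by move=> gw xd; rewrite /version mem_set//; exact: dyadic_extension_dyadic.
Qed.

Lemma cvg_version w t x : finite_energy w -> t \in `[0, 1] -> unit_cube x ->
  X t (dyadic_floor n x) w @[n --> \oo] --> version t x w.
Proof.
move=> gw t01 xc; rewrite /version mem_set//.
exact: (cvg_dyadic_extension d_gt0 (path_bound_ge0 w) psi_small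
  (path_mod gw t01)).
Qed.

Lemma version_floor w t x : t \in `[0, 1] -> unit_cube x ->
  version t (dyadic_floor n x) w @[n --> \oo] --> version t x w.
Proof.
move=> t01; apply: (@cvg_modulus_floor R d H d_gt0 psi _ (version_bound_ge0 w)
  psi_small (fun x => version t x w)).
by move=> ? ? ? ?; exact: version_modulus.
Qed.

Lemma version_continuous : continuous_in_space P version.
Proof.
apply: aeW => w t t01.
apply: (modulus_continuous d_gt0 (version_bound_ge0 w) psi_small).
by move=> ? ? ? ?; exact: version_modulus.
Qed.

Let zero_cube : unit_cube (0 : 'rV[R]_d).
Proof. by move=> i; rewrite mxE in_itv/= lexx ler01. Qed.

Hypothesis X_field : stochastic_field X.

(** At each outcome the version is the limit of values of the field at projections, glued with the
    value at the origin. *)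
Lemma version_field : stochastic_field version.
Proof.
move=> t x t01 xc; apply: (@measurable_fun_cvg_borel _ _ _ _ (fun n w =>
    if w \in finite_energy then X t (dyadic_floor n x) w else X t 0 w)).
  move=> n; apply: measurable_fun_if_set; first exact: finite_energy_measurable.
    by apply: X_field => //; exact: dyadic_pt_cube.
  exact: X_field.
move=> w; have [gw|ngw] := pselect (finite_energy w).
  by under eq_fun do rewrite mem_set//; exact: cvg_version.
by rewrite /version memNset//; exact: cvg_cst.
Qed.

Lemma path_bound_powR w : finite_energy w ->
  (path_bound w `^ gamma)%:E = ((path_const `^ gamma)%:E * (energy w + 1))%E.
Proof.
move=> gw; rewrite powRM ?path_const_ge0 ?powR_ge0// -powRrM mulVf ?gt_eqF//.
have u0 : 0 <= fine (energy w) by rewrite fine_ge0// energy_ge0.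
by rewrite powRr1 ?addr_ge0// EFinM EFinD fineK.
Qed.

(** * Agreement of the version with the field *)

Lemma cvg_sup_incr_floor w x (u : nat -> R) : unit_cube x ->
  u n @[n --> \oo] --> 0 ->
  (forall n, (sup_incr (dyadic_floor n x) x w <= (u n `^ gamma)%:E)%E) ->
  (forall n, 0 <= u n) ->
  forall t, t \in `[0, 1] ->
  X t (dyadic_floor n x) w @[n --> \oo] --> X t x w.
Proof.
move=> xc u0 hu u_ge0 t t01; apply/cvgrPdist_le => e e0.
have /cvgrPdist_le/(_ e e0) := u0; apply: filterS => n /=.
rewrite sub0r normrN ger0_norm//; apply: le_trans.
rewrite distrC -[leLHS]powRr1// -[leRHS]powRr1//.
rewrite -(mulfV (lt0r_neq0 gamma_gt0)) !powRrM.
apply: ge0_ler_powR; rewrite ?invr_ge0 ?(ltW gamma_gt0) ?nnegrE ?powR_ge0//.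
rewrite -lee_fin; apply: le_trans (hu n).
exact: (le_sup01 (fun t => (`|X t (dyadic_floor n x) w - X t x w| `^ gamma)%:E)).
Qed.

Definition agreement x : set T :=
  [set w | forall t : R, t \in `[0, 1] -> version t x w = X t x w].

(** This removes the uncountable quantifier over time. At finite energy, agreement forces the
    modulus bound between [x] and its projections; conversely that bound makes the field at the
    projections converge to its value at [x], hence equal the version. The bound is expressed
    through [energy + 1] to be measurable in [w]. *)
Lemma agreementE x : unit_cube x -> agreement x =
  (finite_energy `&` \bigcap_n [set w | (sup_incr (dyadic_floor n x) x w <=
     ((path_const * psi (enorm (dyadic_floor n x - x))) `^ gamma)%:E *
       (energy w + 1))%E]) `|`
  (~` finite_energy `&` [set w | (sup_incr 0 x w <= 0)%E]).
Proof.
move=> xc; apply/seteqP; split => w.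
  move=> Ew; have [gw|ngw] := pselect (finite_energy w); [left|right]; split => //.
    move=> n _ /=; rewrite powRM ?path_const_ge0 ?powR_ge0// EFinM muleAC.
    rewrite -path_bound_powR// -EFinM -powRM ?path_bound_ge0 ?powR_ge0//.
    apply: sup01_le => t t01; rewrite lee_fin; apply: ge0_ler_powR.
    - exact: ltW.
    - by rewrite nnegrE.
    - by rewrite nnegrE mulr_ge0 ?path_bound_ge0 ?powR_ge0.
    rewrite -Ew// -(version_dyadic t gw (dyadic_dyadic_floor n x)).
    have := version_modulus w t01 (dyadic_cube (dyadic_dyadic_floor n x)) xc.
    by rewrite /version_bound mem_set.
  apply: sup01_le => t t01; rewrite -Ew// /version memNset// subrr normr0.
  by rewrite powR0 ?gt_eqF.
case=> [[gw hw]|[ngw hw]] t t01.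
  have c1 := cvg_version gw t01 xc; apply: (cvg_unique _ c1) => //.
  apply: (@cvg_sup_incr_floor w x
    (fun n => path_bound w * psi (enorm (dyadic_floor n x - x)))) => //.
  - apply/cvgrPdist_lt => e e0.
    have [N hN] := modulus_floor_small d_gt0 (path_bound_ge0 w) psi_small e0.
    exists N => // n /= Nn; rewrite sub0r normrN ger0_norm.
      apply: (hN n) => // [|i]; first exact: dyadic_pt_cube.
      by rewrite distrC; have /andP[? ?] := dyadic_floor_bounds n i xc;
        rewrite ger0_norm// ltW.
    by rewrite mulr_ge0 ?path_bound_ge0 ?powR_ge0.
  - move=> n; apply: (le_trans (hw n I)).
    rewrite powRM ?path_const_ge0 ?powR_ge0// EFinM muleAC.
    by rewrite -path_bound_powR// -EFinM -powRM ?path_bound_ge0 ?powR_ge0.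
  - by move=> n; rewrite mulr_ge0 ?path_bound_ge0 ?powR_ge0.
rewrite /version memNset//; apply/eqP; rewrite -subr_eq0 -normr_eq0.
have : (`|X t 0 w - X t x w| `^ gamma)%:E = 0%E.
  apply/le_anti/andP; split; last by rewrite lee_fin powR_ge0.
  apply: le_trans hw.
  exact: (le_sup01 (fun t => (`|X t 0 w - X t x w| `^ gamma)%:E)).
by move=> [] /eqP; rewrite powR_eq0 => /andP[].
Qed.

Lemma agreement_measurable x : unit_cube x -> measurable (agreement x).
Proof.
move=> xc; rewrite agreementE//; have mg := finite_energy_measurable.
apply: measurableU; apply: measurableI => //.
- apply: bigcap_measurableType => n _; rewrite -[X in measurable X]setTI.
  apply: measurable_lee => //.
    by apply: sup_incr_measurable => //; exact: dyadic_pt_cube.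
  apply: measurable_funeM; apply: emeasurable_funD => //.
  exact: energy_measurable.
- exact: measurableC.
- rewrite -[X in measurable X]setTI; apply: measurable_lee => //.
  exact: sup_incr_measurable.
Qed.

(** The moments are at most a constant times [2 ^- n], so the series of increments has finite
    expectation and converges almost surely. *)
Lemma floor_increments_ae x : unit_cube x -> {ae P, forall w,
  sup_incr (dyadic_floor n x) x w @[n --> \oo] --> 0%E}.
Proof.
move=> xc; have fc n := dyadic_cube (dyadic_dyadic_floor n x).
pose S w := (\sum_(0 <= n <oo) sup_incr (dyadic_floor n x) x w)%E.
have si0 n w : (0 <= sup_incr (dyadic_floor n x) x w)%E by exact: sup_incr_ge0.
have mS : measurable_fun [set: T] S.
  apply: (@ge0_emeasurable_sum _ _ _ _ _ xpredT) => // n _.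
  exact: sup_incr_measurable.
have pd : 0 <= phi d%:R by rewrite ltW// phi_gt0// ltr0n.
have : P.-integrable [set: T] S.
  apply/integrableP; split => //.
  under eq_integral do rewrite gee0_abs ?nneseries_ge0//.
  rewrite integral_nneseries//; last by move=> n; exact: sup_incr_measurable.
  apply: (@le_lt_trans _ _
      (\sum_(0 <= n <oo) ((C * d%:R ^+ d * phi d%:R)%:E * (2 ^- n)%:E))%E).
    apply: lee_nneseries => n _; first by move=> _; exact: integral_ge0.
    apply: (le_trans (sup_incr_moment (fc n) xc)); rewrite -EFinM lee_fin.
    have e0 := enorm_ge0 (dyadic_floor n x - x).
    have ed := enorm_floor_le n d_gt0 xc.
    have h1 : (2 : R) ^- n <= 1.
      by rewrite invf_le1 ?exprn_gt0// exprn_ege1// ler1n.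
    rewrite [leRHS]mulrAC -[X in _ <= X * _]mulrA.
    apply: ler_pM; rewrite ?mulr_ge0 ?exprn_ge0//.
    - by rewrite -phi_at0 phi_nd0.
    - rewrite ler_wpM2l//.
      apply: (@le_trans _ _ ((d%:R * 2 ^- n) ^+ d)).
        by rewrite lerXn2r ?nnegrE// mulr_ge0// ltW.
      rewrite exprMn ler_wpM2l ?exprn_ge0//.
      (* Since [d >= 1], one factor [2 ^- n] already bounds the full power. *)
      by rewrite -[leRHS]expr1 ler_wiXn2l// ltW.
    - apply: phi_nd0 => //; apply: (le_trans ed).
      by rewrite ler_piMr.
  rewrite nneseriesZl; last by move=> n _; rewrite lee_fin ltW.
  rewrite lte_mul_pinfty ?lee_fin ?mulr_ge0 ?exprn_ge0//.
  rewrite (_ : (fun n => _) =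
      eseries (fun k => (2 / (2 ^ (k + 1))%:R)%:E)); last first.
    apply/funext => n; apply: eq_bigr => k _.
    by rewrite natrX exprD expr1 invfM mulrCA mulfV// mulr1.
  by rewrite (cvg_lim _ (@cvg_geometric_eseries_half R 2 0))// ltry.
move=> /(integrable_ae measurableT); apply: filterS => w /(_ I) Sfin.
have Soo : (S w < +oo)%E by move: Sfin; rewrite ge0_fin_numE// nneseries_ge0.
(* The [n]-th term is at most the tail starting at [n]. *)
have tail := nneseries_tail_cvg Soo (fun k _ => si0 k w).
apply: squeeze_cvge tail; last exact: cvg_cst.
apply: nearW => n; rewrite si0/=.
have := @nneseries_lim_ge R (fun k => sup_incr (dyadic_floor k x) x w) xpredT n n.+1.
by rewrite big_nat1; apply.
Qed.

(** The field at the projections converges both to the version and to the field at [x]. Since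
    [sup_incr] controls all times at once, the exceptional null set does not depend on [t]. *)
Lemma agreement_ae x : unit_cube x -> {ae P, forall w, agreement x w}.
Proof.
move=> xc; apply: filterS2 finite_energy_ae (floor_increments_ae xc).
move=> w gw sw t t01; apply: (cvg_unique _ (cvg_version gw t01 xc)) => //.
apply/cvgrPdist_le => e e0.
have eg0 : 0 < e `^ gamma by rewrite powR_gt0.
have : \forall n \near \oo, (sup_incr (dyadic_floor n x) x w < (e `^ gamma)%:E)%E.
  exact: (sw _ (@nbhs_open_ereal_lt R 0 (cst (e `^ gamma)) eg0)).
apply: filterS => n /ltW h; rewrite distrC.
rewrite -[leLHS]powRr1// -[leRHS](powRr1 (ltW e0)).
rewrite -(mulfV (lt0r_neq0 gamma_gt0)) !powRrM.
apply: ge0_ler_powR; rewrite ?invr_ge0 ?(ltW gamma_gt0) ?nnegrE ?powR_ge0//.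
rewrite -lee_fin; apply: le_trans h.
exact: (le_sup01 (fun t => (`|X t (dyadic_floor n x) w - X t x w| `^ gamma)%:E)).
Qed.

Lemma version_realization : realization P X version.
Proof.
split; first exact: version_field.
move=> x xc E; have mE : measurable E by exact: agreement_measurable.
split => //; rewrite -[E]setCK probability_setC; last exact: measurableC.
by rewrite (negligibleP _ (measurableC mE)).1 ?sube0//; exact: agreement_ae.
Qed.

(** * Expectation of the seminorm *)

Section expectation.
Variable alpha : R.
Hypothesis alpha_le : alpha <= gamma^-1 - theta.

Let Z w : \bar R :=
  sup01 (fun t => (phi_seminorm phi alpha (fun x => version t x w) `^ gamma)%E).

(** On [finite_energy] the version equals the field at dyadic points; off it all spatial increments
    vanish. Gluing the two cases leaves only [sup_incr]. *)
Lemma version_pair_measurable n : measurable_fun [set: T]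
  (fun w => dyadic_pair_sup phi alpha gamma n (fun t x => version t x w)).
Proof.
rewrite /dyadic_pair_sup; case: (unpickle n) => [[[m a] a']|];
  last exact: measurable_cst.
set x := dyadic_pt R m a; set y := dyadic_pt R m a'; rewrite /=.
case: (x == y); first exact: measurable_cst.
apply: measurable_funeM.
rewrite (_ : (fun w => _) =
    (fun w => if w \in finite_energy then sup_incr x y w else cst 0%E w)).
  apply: measurable_fun_if_set => //; first exact: finite_energy_measurable.
  by apply: sup_incr_measurable; exact: dyadic_pt_cube.
apply/funext => w; case: ifPn => [/set_mem gw|ngw].
  by apply: eq_sup01 => t _; rewrite !version_dyadic//; do 2 eexists.
apply/le_anti/andP; split; last first.
  by apply: sup01_ge0 => t; rewrite lee_fin powR_ge0.
apply: sup01_le => t _.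
by rewrite /version (negbTE ngw) subrr normr0 powR0 ?gt_eqF.
Qed.

Lemma version_seminorm_measurable : measurable_fun [set: T] Z.
Proof.
rewrite (_ : Z = fun w => esups (fun n =>
    dyadic_pair_sup phi alpha gamma n (fun t x => version t x w)) 0).
  by apply: measurable_fun_esups => n; exact: version_pair_measurable.
apply/funext => w; apply: sup_phi_seminormE => // t x t01 xc.
exact: version_floor.
Qed.

(** The surplus exponent [gamma^-1 - theta - alpha] is nonnegative, so its power of [phi] is largest
    at the largest distance, for which [d] is a crude bound. *)
Lemma version_seminorm_le w : (Z w <= ((path_const *
  phi d%:R `^ (gamma^-1 - theta - alpha)) `^ gamma)%:E * (energy w + 1))%E.
Proof.
have dphi0 : 0 < phi d%:R by rewrite phi_gt0// ltr0n.
set D := phi d%:R `^ _; have D0 : 0 <= D by exact: powR_ge0.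
apply: sup01_le => t t01.
have semi : (phi_seminorm phi alpha (fun x => version t x w) <=
    (version_bound w * D)%:E)%E.
  apply: ge_ereal_sup => _ [[x y] /= [xc yc xy] <-]; rewrite lee_fin.
  have r0 : 0 < enorm (x - y) by rewrite enorm_gt0// subr_eq0.
  have p0 := phi_gt0 r0.
  rewrite ler_pdivrMr ?powR_gt0//.
  apply: (le_trans (version_modulus w t01 xc yc)).
  rewrite -mulrA ler_wpM2l ?version_bound_ge0//.
  rewrite /psi -[X in phi _ `^ X](subrK alpha) powRD; last first.
    by rewrite (gt_eqF p0) implybT.
  rewrite ler_wpM2r ?powR_ge0//; apply: ge0_ler_powR;
    rewrite ?subr_ge0 ?nnegrE ?(ltW p0) ?(ltW dphi0)//.
  apply: phi_nd => //; rewrite -[leRHS]mulr1; apply: enorm_le => // i.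
  have := xc i; have := yc i; rewrite coordB !in_itv/= => /andP[? ?] /andP[? ?].
  by rewrite ler_norml; lra.
apply: (@le_trans _ _ ((version_bound w * D) `^ gamma)%:E).
  rewrite -poweR_EFin; apply: gt0_ler_poweR;
    rewrite ?(ltW gamma_gt0) ?in_itv/= ?leey ?andbT//.
  - exact: phi_seminorm_ge0.
  - by rewrite lee_fin mulr_ge0// version_bound_ge0.
rewrite /version_bound; case: ifPn => [/set_mem gw|_].
  rewrite (powRM _ (path_bound_ge0 w) D0) (powRM _ path_const_ge0 D0).
  rewrite !EFinM [leRHS]muleAC.
  by rewrite path_bound_powR.
rewrite mul0r powR0 ?gt_eqF// mule_ge0 ?lee_fin ?powR_ge0//.
by rewrite adde_ge0 ?energy_ge0.
Qed.

Lemma version_finite_expectation : finite_expectation P Z.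
Proof.
split; first exact: version_seminorm_measurable.
have mV : measurable_fun [set: T] (fun w => energy w + 1)%E.
  by apply: emeasurable_funD => //; exact: energy_measurable.
pose c := (path_const * phi d%:R `^ (gamma^-1 - theta - alpha)) `^ gamma.
apply: (@le_lt_trans _ _ (\int[P]_w (c%:E * (energy w + 1)))%E).
  apply: ge0_le_integral => //; first 1 last.
  - exact: version_seminorm_measurable.
  - exact: measurable_funeM.
  - by move=> w _; exact: version_seminorm_le.
  - by move=> w _; apply: sup01_ge0 => t; exact: poweR_ge0.
rewrite ge0_integralZl_EFin ?powR_ge0//; last first.
  by move=> w _; rewrite adde_ge0 ?energy_ge0.
rewrite lte_mul_pinfty ?lee_fin ?powR_ge0//.
rewrite ge0_integralD//; last 2 first.
- by move=> w _; exact: energy_ge0.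
- exact: energy_measurable.
rewrite integral_cst// mul1e; apply: lte_add_pinfty; first exact: energy_moment.
by apply: (le_lt_trans (probability_le1 P measurableT)); exact: ltry.
Qed.

End expectation.
End energy.

(** * From the stated hypotheses to those of the construction *)

Unset Implicit Arguments.

Theorem theorem1p1 (R : realType) (H : completeNormedModType R)
    (d : nat) (hd : (1 <= d)%N)
    (disp : measure_display) (T : measurableType disp) (P : probability T R)
    (X : R -> 'rV[R]_d -> T -> H) (hX : stochastic_field X)
    (phi : R -> R)
    (phi_at0 : phi 0 = 0)
    (phi_ge0 : forall r : R, 0 < r -> 0 <= phi r)
    (phi_nd : forall r s : R, 0 < r -> r <= s -> phi r <= phi s)
    (phi_cont : {within `]0, +oo[, continuous phi})
    (phi_lim0 : phi r @[r --> 0^'+] --> 0)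
    (gamma C : R) (gamma_gt0 : 0 < gamma) (C_gt0 : 0 < C)
    (hmeas : forall x y, unit_cube x -> unit_cube y ->
      measurable_fun [set: T]
        (fun w => sup01 (fun t => (`|X t x w - X t y w| `^ gamma)%:E)))
    (hmoment : forall x y, unit_cube x -> unit_cube y ->
      (\int[P]_w sup01 (fun t => (`|X t x w - X t y w| `^ gamma)%:E)
         <= (C * enorm (x - y) ^+ d * phi (enorm (x - y)))%:E)%E)
    (theta : R) (theta_gt0 : 0 < theta) (theta_lt : theta < 1 / gamma)
    (hsum_ge1 : 1 <= gamma ->
      (\sum_(0 <= i <oo) (phi (2 ^- i) `^ theta)%:E < +oo)%E)
    (hsum_lt1 : gamma < 1 ->
      (\sum_(0 <= i <oo) (phi (2 ^- i) `^ (gamma * theta))%:E < +oo)%E)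
    (lambda : R) (lambda_ge1 : 1 <= lambda)
    (hratio : \forall n \near \oo,
      lambda^-1 <= phi (2 ^- n) / phi (2 ^- n.+1) <= lambda) :
  exists Y : R -> 'rV[R]_d -> T -> H,
    [/\ realization P X Y,
        continuous_in_space P Y &
        forall alpha : R, 0 < alpha <= 1 / gamma - theta ->
          finite_expectation P (fun w =>
            sup01 (fun t =>
              (phi_seminorm phi alpha (fun x => Y t x w) `^ gamma)%E))].
Proof.
have phi_gt0 := ratio_phi_gt0 phi_ge0 phi_nd lambda_ge1 hratio.
have phi_c (r : R) : 0 < r -> {for r, continuous phi}.
  move=> r0; have rI : [set` `]0, +oo[%R] r by rewrite /= in_itv/= r0.
  have := (subspace_continuousP _ _).1 phi_cont r rI.
  by rewrite within_interior//; apply: near_in_itvoy; rewrite in_itv/= r0.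
(* Neighbours differ by at most [4 * 2 ^- m] in each coordinate, hence by at most [d * 4 * 2 ^- m]
   in norm. *)
have D0 : 0 < d%:R * 4 :> R by rewrite mulr_gt0 ?ltr0n.
have [K K0 hK] := ratio_doubling phi_ge0 phi_nd lambda_ge1 hratio D0.
(* The minimum merges the two summability assumptions: the exponent is [theta] for [1 <= gamma] and
   [gamma * theta] otherwise. *)
have hsum : (\sum_(0 <= m <oo)
    (phi (2 ^- m) `^ (theta * Num.min gamma 1))%:E < +oo)%E.
  have [g1|g1] := ltP gamma 1; last by rewrite mulr1; exact: hsum_ge1.
  by rewrite mulrC; exact: hsum_lt1.
rewrite div1r in theta_lt *; have C0 := ltW C_gt0.
exists (version X phi gamma theta); split.
- exact: (version_realization hd phi_at0 phi_gt0 phi_nd phi_c phi_lim0 gamma_gt0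
    theta_lt C0 hmeas hmoment K0 hK hsum hX).
- exact: (version_continuous hd P X phi_at0 phi_gt0 phi_nd phi_c phi_lim0
    gamma_gt0 theta_lt C0 hsum).
- move=> alpha /andP[_ ale].
  exact: (version_finite_expectation hd phi_at0 phi_gt0 phi_nd phi_c phi_lim0
    gamma_gt0 theta_lt C0 hmeas hmoment K0 hK hsum ale).
Qed.
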